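(* Consider the Stackelberg Q-value iteration $(Q^1_k,Q^2_k)_{k\ge 0}$ for a two-player general-sum Markov game with discount factor $\gamma\in[0,1)$, and let $(Q^1_*,Q^2_* )$ with policies $(a_*,b_* )$ be a Stackelberg fixed point (all as defined in the context). Assume $|r^i(s,a,b)|\le 1$ for all $(s,a,b)\in\mathcal S\times\mathcal A\times\mathcal B$ and $i\in\{1,2\}$, and $\|Q^1_0\|_\infty\le 1$, $\|Q^2_0\|_\infty\le 1$. Let $\epsilon>0$ be such that for every state $s\in\mathcal S$, all policies $\mu^1:\mathcal S\to\mathcal A$, $\mu^2:\mathcal S\to\mathcal B$, and every $k\ge 0$, $$Q^1_k(s,a_k(s),b_k(s,a_k(s)))\le Q^1_k(s,a_k(s),\mu^2(s))+\epsilon,$$ $$Q^2_k(s,a_k(s),b_k(s,a_k(s)))\le Q^2_k(s,\mu^1(s),b_k(s,a_k(s)))+\epsilon,$$ $$Q^1_*(s,a_*(s),b_*(s,a_*(s)))\le Q^1_*(s,a_*(s),\mu^2(s))+\epsilon,$$ $$Q^2_*(s,a_*(s),b_*(s,a_*(s)))\le Q^2_*(s,\mu^1(s),b_*(s,a_*(s)))+\epsilon.$$ Then for all $k\ge 0$, $$\left\|Q^1_k-Q^1_*\right\|_\infty\le \frac{6}{1-\gamma}\gamma^k+\frac{3\epsilon}{1-\gamma}.$$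
   Context: $\mathcal S$, $\mathcal A$, $\mathcal B$ are nonempty finite sets (states, leader actions, follower actions). $P(\cdot\mid s,a,b)$ is a probability distribution on $\mathcal S$ for each $(s,a,b)\in\mathcal S\times\mathcal A\times\mathcal B$. $r^1,r^2:\mathcal S\times\mathcal A\times\mathcal B\to\mathbb R$ are the reward functions of the leader (player 1) and follower (player 2), and $\gamma\in[0,1)$ is the discount factor. For $Q:\mathcal S\times\mathcal A\times\mathcal B\to\mathbb R$, $\|Q\|_\infty=\max_{s,a,b}|Q(s,a,b)|$. Stackelberg Q-value iteration: starting from $Q^1_0,Q^2_0:\mathcal S\times\mathcal A\times\mathcal B\to\mathbb R$, for each $k\ge 0$ define $$b_k(s,a)\in\arg\max_{b\in\mathcal B}Q^2_k(s,a,b),\qquad a_k(s)\in\arg\max_{a\in\mathcal A}Q^1_k(s,a,b_k(s,a)),$$ and $$Q^1_{k+1}(s,a,b)=r^1(s,a,b)+\gamma\sum_{s'\in\mathcal S}P(s'\mid s,a,b)\max_{a'\in\mathcal A}Q^1_k(s',a',b_k(s',a')),$$ $$Q^2_{k+1}(s,a,b)=r^2(s,a,b)+\gamma\sum_{s'\in\mathcal S}P(s'\mid s,a,b)\max_{b'\in\mathcal B}Q^2_k(s',a_k(s'),b').$$ Stackelberg fixed point: functions $Q^1_*,Q^2_*:\mathcal S\times\mathcal A\times\mathcal B\to\mathbb R$ together with policies $$b_*(s,a)\in\arg\max_{b\in\mathcal B}Q^2_*(s,a,b),\qquad a_*(s)\in\arg\max_{a\in\mathcal A}Q^1_*(s,a,b_*(s,a)),$$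 satisfying $$Q^1_*(s,a,b)=r^1(s,a,b)+\gamma\sum_{s'\in\mathcal S}P(s'\mid s,a,b)\,Q^1_*(s',a_*(s'),b_*(s',a_*(s'))),$$ $$Q^2_*(s,a,b)=r^2(s,a,b)+\gamma\sum_{s'\in\mathcal S}P(s'\mid s,a,b)\,Q^2_*(s',a_*(s'),b_*(s',a_*(s'))).$$ Standing convention: all the $\arg\max$'s above are assumed to have a unique maximizer. *)

(* Defs.v *)
From HB Require Import structures.
From mathcomp Require Import all_boot all_order all_algebra.
From mathcomp Require Import reals.

Set Implicit Arguments.
Unset Strict Implicit.
Unset Printing Implicit Defensive.

Import Order.TTheory GRing.Theory Num.Theory.
Local Open Scope ring_scope.

(* The maximum of F over a nonempty finite type T; the value 0 on an empty T
   is a junk value. *)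
Definition fmax (R : realType) (T : finType) (F : T -> R) : R :=
  if [pick x : T] is Some x0 then \big[Num.max/F x0]_(x : T) F x else 0.

Lemma fmax_ge (R : realType) (T : finType) (F : T -> R) (x : T) :
  F x <= fmax F.
Proof.
rewrite /fmax; case: pickP => [x0 _|/(_ x)//].
exact: le_bigmax_cond.
Qed.

Lemma fmax_attained (R : realType) (T : finType) (F : T -> R) :
  (0 < #|T|)%N -> exists x, fmax F = F x.
Proof.
move=> /card_gt0P[y _]; rewrite /fmax; case: pickP => [x0 _|/(_ y)//].
elim/big_ind: _ => [|u v [x ->] [z ->]|i _]; [by exists x0| |by exists i].
by case: leP => _; [exists z | exists x].
Qed.

Definition argmax (R : realType) (T : finType) (F : T -> R) : {set T} :=
  [set x | [forall y, F y <= F x]].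

Definition unique_argmax (R : realType) (T : finType) (F : T -> R) (x : T) :
    Prop :=
  x \in argmax F /\ #|argmax F| = 1%N.

Definition supnorm (R : realType) (S A B : finType) (Q : S -> A -> B -> R) : R :=
  fmax (fun t : S * A * B => `|Q t.1.1 t.1.2 t.2|).

(* transition G s a b s' is P(s' | s, a, b); player 1 is the leader, with
   actions in A, and player 2 is the follower, with actions in B. *)
Record markov_game (R : realType) (S A B : finType) := MarkovGame {
  transition : S -> A -> B -> S -> R;
  reward1 : S -> A -> B -> R;
  reward2 : S -> A -> B -> R;
  discount : R;
  transition_ge0 : forall s a b s', 0 <= transition s a b s';
  transition_sum1 : forall s a b, \sum_(s' : S) transition s a b s' = 1;
  discount_ge0 : 0 <= discount;
  discount_lt1 : discount < 1
}.

(* The follower's policy depends on the leader's action as well as on the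
   state. The policies are data, but unique_argmax determines them from the
   Q-functions. *)
Record stackelberg_iteration (R : realType) (S A B : finType)
    (G : markov_game R S A B) (Q1 Q2 : nat -> S -> A -> B -> R)
    (a_ : nat -> S -> A) (b_ : nat -> S -> A -> B) : Prop :=
  StackelbergIteration {
  iter_follower : forall k s a,
    unique_argmax (fun b => Q2 k s a b) (b_ k s a);
  iter_leader : forall k s,
    unique_argmax (fun a => Q1 k s a (b_ k s a)) (a_ k s);
  iter_Q1 : forall k s a b,
    Q1 k.+1 s a b = reward1 G s a b + discount G *
      \sum_(s' : S) transition G s a b s' *
        fmax (fun a' => Q1 k s' a' (b_ k s' a'));
  iter_Q2 : forall k s a b,
    Q2 k.+1 s a b = reward2 G s a b + discount G *
      \sum_(s' : S) transition G s a b s' *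
        fmax (fun b' => Q2 k s' (a_ k s') b')
}.

Record stackelberg_fixpoint (R : realType) (S A B : finType)
    (G : markov_game R S A B) (Q1 Q2 : S -> A -> B -> R)
    (a_ : S -> A) (b_ : S -> A -> B) : Prop :=
  StackelbergFixpoint {
  fix_follower : forall s a, unique_argmax (fun b => Q2 s a b) (b_ s a);
  fix_leader : forall s, unique_argmax (fun a => Q1 s a (b_ s a)) (a_ s);
  fix_Q1 : forall s a b,
    Q1 s a b = reward1 G s a b + discount G *
      \sum_(s' : S) transition G s a b s' * Q1 s' (a_ s') (b_ s' (a_ s'));
  fix_Q2 : forall s a b,
    Q2 s a b = reward2 G s a b + discount G *
      \sum_(s' : S) transition G s a b s' * Q2 s' (a_ s') (b_ s' (a_ s'))
}.

(* Main.v *)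
Require Import Defs.
From HB Require Import structures.
From mathcomp Require Import all_boot all_order all_algebra.
From mathcomp Require Import reals.
From mathcomp Require Import ring lra.

Set Implicit Arguments.
Unset Strict Implicit.
Unset Printing Implicit Defensive.

Import Order.TTheory GRing.Theory Num.Theory.
Local Open Scope ring_scope.

(* The cooperation hypothesis makes the leader's fixed-point operator almost a
   contraction. Comparing the values of two Q-functions at the leader's action
   of one and the follower's reply of the other, the change of reply costs at
   most eps, and optimality of the leader does the rest: the values differ by at
   most the distance of the Q-functions plus eps. Hence the errors satisfy
   e (k + 1) <= gamma * (e k + eps), while e 0 <= 1 + 1 / (1 - gamma). *)

Lemma argmaxP (R : realType) (T : finType) (F : T -> R) (x : T) :
  reflect (forall y, F y <= F x) (x \in argmax F).
Proof. by rewrite inE; apply: forallP. Qed.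

Lemma fmax_argmax (R : realType) (T : finType) (F : T -> R) (x : T) :
  x \in argmax F -> fmax F = F x.
Proof.
move=> /argmaxP Fx; apply/eqP; rewrite eq_le fmax_ge andbT.
have [|y ->] := @fmax_attained R T F; last exact: Fx.
by apply/card_gt0P; exists x.
Qed.

Section Supnorm.
Variables (R : realType) (S A B : finType).
Implicit Types (Q : S -> A -> B -> R) (c : R).

Lemma supnorm_ge Q s a b : `|Q s a b| <= supnorm Q.
Proof.
exact: (fmax_ge (fun t : S * A * B => `|Q t.1.1 t.1.2 t.2|) (s, a, b)).
Qed.

(** The hypothesis [0 <= c] covers an empty index type, where [fmax] takes its default value 0. *)
Lemma supnorm_le Q c :
  0 <= c -> (forall s a b, `|Q s a b| <= c) -> supnorm Q <= c.
Proof.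
move=> c0 Qc; rewrite /supnorm /fmax; case: pickP => // x0 _.
by apply/bigmax_leP; split.
Qed.

Lemma supnorm_ge0 Q : 0 <= supnorm Q.
Proof.
rewrite /supnorm /fmax; case: pickP => // x0 _.
by apply: le_trans (bigmax_ge_id _ _ _ _).
Qed.

Lemma supnormB Q Q' :
  supnorm (fun s a b => Q s a b - Q' s a b) <= supnorm Q + supnorm Q'.
Proof.
apply: supnorm_le => [|s a b]; first by rewrite addr_ge0 ?supnorm_ge0.
by apply: le_trans (ler_normB _ _) _; rewrite lerD ?supnorm_ge.
Qed.

End Supnorm.

Section Game.
Variables (R : realType) (S A B : finType) (G : markov_game R S A B).
Local Notation gamma := (discount G).

Lemma expectation_norm_le (V : S -> R) (c : R) s a b :
  (forall s', `|V s'| <= c) ->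
  `|\sum_(s' : S) transition G s a b s' * V s'| <= c.
Proof.
move=> Vc; apply: le_trans (ler_norm_sum _ _ _) _.
(* The bound [c] is spread over the transition probabilities, so that the sums compare term by
   term. *)
rewrite -[leRHS]mul1r -(transition_sum1 G s a b) mulr_suml.
apply: ler_sum => s' _.
by rewrite normrM ger0_norm ?transition_ge0 // ler_wpM2l ?transition_ge0.
Qed.

(** The rewards cancel and averaging does not increase the gap. The state values [V] and [V'] stay
    abstract, so that one may be the maximum in the iteration and the other the policy value in the
    fixed point. *)
Lemma backup_contracts (r Q Q' : S -> A -> B -> R) (V V' : S -> R) (c : R) :
  0 <= c ->
  (forall s a b, Q s a b =
     r s a b + gamma * \sum_(s' : S) transition G s a b s' * V s') ->
  (forall s a b, Q' s a b =
     r s a b + gamma * \sum_(s' : S) transition G s a b s' * V' s') ->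
  (forall s, `|V s - V' s| <= c) ->
  supnorm (fun s a b => Q s a b - Q' s a b) <= gamma * c.
Proof.
move=> c0 QE Q'E Vc; apply: supnorm_le => [|s a b].
  by rewrite mulr_ge0 ?discount_ge0.
rewrite QE Q'E opprD addrACA subrr add0r -mulrBr -sumrB.
under eq_bigr do rewrite -mulrBr.
rewrite normrM ger0_norm ?discount_ge0 // ler_wpM2l ?discount_ge0 //.
exact: expectation_norm_le.
Qed.

(** The fixed-point equation bounds the norm by 1 plus [gamma] times itself; this is solved using
    [gamma < 1]. *)
Lemma supnorm_fixpoint_le (Q1 Q2 : S -> A -> B -> R) a_ b_ :
  stackelberg_fixpoint G Q1 Q2 a_ b_ ->
  (forall s a b, `|reward1 G s a b| <= 1) ->
  supnorm Q1 <= (1 - gamma)^-1.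
Proof.
move=> hfix hr.
have g0 := discount_ge0 G; have g1 := discount_lt1 G.
suff M1 : supnorm Q1 <= 1 + gamma * supnorm Q1.
  by rewrite -[leRHS]mul1r ler_pdivlMr ?subr_gt0 //; lra.
apply: supnorm_le => [|s a b].
  by rewrite addr_ge0 // mulr_ge0 ?supnorm_ge0.
rewrite (fix_Q1 hfix); apply: le_trans (ler_normD _ _) _; apply: lerD => //.
rewrite normrM ger0_norm // ler_wpM2l //.
by apply: expectation_norm_le => s'; apply: supnorm_ge.
Qed.

End Game.

Section LeaderValue.
Variables (R : realType) (A B : finType) (Q Q' : A -> B -> R).
Variables (a0 a0' : A) (b0 : B) (b' : A -> B) (e eps : R).

(** At one state, [Q a0 b0 <= Q a0 (b' a0) + eps <= Q' a0 (b' a0) + e + eps <= Q' a0' (b' a0') + e +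
    eps]. The bound is one-sided; exchanging the two Q-functions gives the other side. *)
Lemma leader_value_le :
  (forall a c, `|Q a c - Q' a c| <= e) ->
  a0' \in argmax (fun a => Q' a (b' a)) ->
  (forall c, Q a0 b0 <= Q a0 c + eps) ->
  Q a0 b0 - Q' a0' (b' a0') <= e + eps.
Proof.
move=> Qe /argmaxP/(_ a0) opt /(_ (b' a0)) coop.
have := Qe a0 (b' a0); rewrite ler_norml => /andP[_ ?]; lra.
Qed.

End LeaderValue.

(** The map [x |-> gamma * (x + d)] has fixed point [gamma * d / (1 - gamma)]; the larger
    [d / (1 - gamma)] leaves a slack of [d * (1 - gamma)] in each induction step. *)
Lemma affine_recurrence_le (R : realType) (e : nat -> R) (gamma d : R) :
  0 <= gamma -> gamma < 1 -> 0 <= d ->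
  (forall k, e k.+1 <= gamma * (e k + d)) ->
  forall k, e k <= gamma ^+ k * e 0%N + d / (1 - gamma).
Proof.
move=> g0 g1 d0 rec; elim=> [|k IH].
  by rewrite expr0 mul1r lerDl divr_ge0 // subr_ge0 ltW.
apply: le_trans (rec k) _.
apply: le_trans (ler_wpM2l g0 (lerD IH (lexx d))) _.
have g1' : 1 - gamma != 0 by rewrite gt_eqF // subr_gt0.
have -> : gamma * (gamma ^+ k * e 0%N + d / (1 - gamma) + d) =
          gamma ^+ k.+1 * e 0%N + d / (1 - gamma) - d * (1 - gamma).
  by rewrite exprS; field.
by rewrite gerBl mulr_ge0 // subr_ge0 ltW.
Qed.

Theorem mainTheorem1 (R : realType) (S A B : finType)
  (hS : (0 < #|S|)%N) (hA : (0 < #|A|)%N) (hB : (0 < #|B|)%N)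
  (G : markov_game R S A B)
  (Q1 Q2 : nat -> S -> A -> B -> R)
  (a_ : nat -> S -> A) (b_ : nat -> S -> A -> B)
  (Q1s Q2s : S -> A -> B -> R) (a_s : S -> A) (b_s : S -> A -> B)
  (hiter : stackelberg_iteration G Q1 Q2 a_ b_)
  (hfix : stackelberg_fixpoint G Q1s Q2s a_s b_s)
  (hr1 : forall s a b, `|reward1 G s a b| <= 1)
  (hr2 : forall s a b, `|reward2 G s a b| <= 1)
  (hQ10 : supnorm (Q1 0%N) <= 1)
  (hQ20 : supnorm (Q2 0%N) <= 1)
  (eps : R) (heps : 0 < eps)
  (hcoop : forall (s : S) (mu1 : S -> A) (mu2 : S -> B) (k : nat),
    [/\ Q1 k s (a_ k s) (b_ k s (a_ k s)) <= Q1 k s (a_ k s) (mu2 s) + eps,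
        Q2 k s (a_ k s) (b_ k s (a_ k s))
          <= Q2 k s (mu1 s) (b_ k s (a_ k s)) + eps,
        Q1s s (a_s s) (b_s s (a_s s)) <= Q1s s (a_s s) (mu2 s) + eps &
        Q2s s (a_s s) (b_s s (a_s s)) <= Q2s s (mu1 s) (b_s s (a_s s)) + eps]) :
  forall k : nat,
    supnorm (fun s a b => Q1 k s a b - Q1s s a b)
      <= 6 / (1 - discount G) * discount G ^+ k + 3 * eps / (1 - discount G).
Proof.
have g0 := discount_ge0 G; have g1 := discount_lt1 G.
have h0 : 0 < 1 - discount G by rewrite subr_gt0.
pose e k := supnorm (fun s a b => Q1 k s a b - Q1s s a b).
have e_rec k : e k.+1 <= discount G * (e k + eps).
  have c0 : 0 <= e k + eps by rewrite addr_ge0 ?supnorm_ge0 ?ltW.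
  apply: (backup_contracts c0 (iter_Q1 hiter k) (fix_Q1 hfix)) => s.
  have [optk _] := iter_leader hiter k s.
  have [opts _] := fix_leader hfix s.
  have dist a b : `|Q1 k s a b - Q1s s a b| <= e k.
    exact: (supnorm_ge (fun s a b => Q1 k s a b - Q1s s a b)).
  (* The lower bound uses cooperation at the fixed point and optimality of [a_ k]; the upper bound
     uses cooperation at the iterate and optimality of [a_s]. Constant policies [mu2] produce every
     reply [c]. *)
  rewrite (fmax_argmax optk) ler_norml lerNl opprB; apply/andP; split.
    apply: (leader_value_le _ optk) => [a c|c]; first by rewrite distrC.
    by have [] := hcoop s (fun=> a_s s) (fun=> c) k.
  apply: (leader_value_le dist opts) => c.
  by have [] := hcoop s (fun=> a_s s) (fun=> c) k.
have inv1 : 1 <= (1 - discount G)^-1 by rewrite invf_ge1 //; lra.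
(* By [inv1], [1 + 1 / (1 - gamma)] is at most [2 / (1 - gamma)], which lies below the stated
   bound. *)
have e0 : e 0%N <= 6 / (1 - discount G).
  have := supnormB (Q1 0%N) Q1s; have := supnorm_fixpoint_le hfix hr1.
  rewrite -/(e 0%N); lra.
move=> k; apply: le_trans (affine_recurrence_le g0 g1 (ltW heps) e_rec k) _.
apply: lerD; first by rewrite mulrC ler_wpM2r ?exprn_ge0.
by rewrite ler_pM2r ?invr_gt0 //; lra.
Qed.
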